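(* Let $k$ be a field with ${\rm char}(k)\ne 2$, let $n\geq 2$ be an integer, and let $g=\mathfrak X_{12}(\tau)\,\mathfrak n(\alpha)\,\mathfrak X_{12}(\psi)\in {\rm SL}_2(k)$ with $\tau,\psi\in k$ and $\alpha\in k^*$. Then the equation $x^n=g$ has a solution $x$ in ${\rm SL}_2(k)$ if and only if the following equations have a (simultaneous) solution $X,Y$ in $k$: (1) $2\alpha f_{n-2}(X,Y)+(-1)^{n-2}XY^{n-2}+(-1)^{n-1}(\tau+\psi)Y^{n-2}=0$, and (2) $\alpha f_{n-1}(X,Y)+(-1)^nY^n=0$, where the $f_r(X,Y)$ are the generalised Fibonacci polynomials.
   Context: For $t\in k$ and $\alpha\in k^*$ set $\mathfrak X_{12}(t)=\begin{pmatrix}1&t\\0&1\end{pmatrix}$ and $\mathfrak n(\alpha)=\begin{pmatrix}0&\alpha\\-\alpha^{-1}&0\end{pmatrix}$. With $B$ the subgroup of upper triangular matrices in ${\rm SL}_2(k)$ and $\mathfrak n=\mathfrak n(1)$, the elements $\mathfrak X_{12}(\tau)\mathfrak n(\alpha)\mathfrak X_{12}(\psi)$ are exactly the elements of the double coset $B\mathfrak nB$. The generalised Fibonacci polynomials $f_r(X,Y)\in\mathbb Z[X,Y]$ are defined by $f_{-1}=0$, $f_0=1$ and $f_r(X,Y)=Xf_{r-1}(X,Y)-Y^2f_{r-2}(X,Y)$ for $r\geq 1$.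
   Formalization: The solution X, Y is required to have Y ≠ 0: otherwise X = Y = 0 solves (1) and (2) for every g when n ≥ 3, although not every g is an n-th power (e.g. k = F_3, n = 3, τ = ψ = 1, α = -1). *)

(* Defs.v *)
From HB Require Import structures.
From mathcomp Require Import all_boot all_order all_algebra.
From mathcomp Require Import mpoly.

Set Implicit Arguments.
Unset Strict Implicit.
Unset Printing Implicit Defensive.

Import GRing.Theory.
Local Open Scope ring_scope.

Definition mx2 (k : fieldType) (a b c d : k) : 'M[k]_2 :=
  \matrix_(i, j) if i == 0 then (if j == 0 then a else b)
                 else (if j == 0 then c else d).

Definition X12 (k : fieldType) (t : k) : 'M[k]_2 := mx2 1 t 0 1.

Definition nmx (k : fieldType) (alpha : k) : 'M[k]_2 :=
  mx2 0 alpha (- alpha^-1) 0.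

(* The product on SL_2(k) is the one of 'M[k]_2, so powers in the group are
   the powers ^+ of the matrix ring. *)
Definition SL2 (k : fieldType) : {pred 'M[k]_2} := [pred x | \det x == 1].
Arguments SL2 k : clear implicits.

(* 'X_0 and 'X_1 play the roles of X and Y.  The index is shifted by one,
   genfib_shift m = f_(m-1), so that the recurrence starts at f_(-1) = 0. *)
Fixpoint genfib_shift (m : nat) : {mpoly int[2]} :=
  match m with
  | 0 => 0
  | m'.+1 => match m' with
             | 0 => 1
             | p.+1 => 'X_0 * genfib_shift m' - 'X_1 ^+ 2 * genfib_shift p
             end
  end.

Definition genfib (r : nat) : {mpoly int[2]} := genfib_shift r.+1.

(* The value of f_r at (x, y), via the canonical ring morphism int -> k. *)
Definition genfib_at (k : fieldType) (r : nat) (x y : k) : k :=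
  mmap (intr : int -> k) (fun i : 'I_2 => if i == 0 then x else y) (genfib r).

(* Main.v *)
Require Import Defs.
From mathcomp Require Import all_boot all_order all_algebra.
From mathcomp Require Import mpoly ring.
Import GRing.Theory.
Local Open Scope ring_scope.

(** With F_r(t) = f_r(t, 1), a matrix x of determinant 1 and trace t satisfies
    x^n = F_{n-1}(t) x - F_{n-2}(t).  Comparing entries, x^n = g determines x
    from t as soon as F_{n-1}(t) <> 0, which the lower left entry
    -1/alpha of g forces.  The two equations are the trace of this identity and
    the equation Y = alpha F_{n-1}(t), homogenised through
    f_r(-tY, Y) = (-Y)^r F_r(t); conversely the matrix they determine has
    determinant 1 because F_{r+1}^2 - t F_{r+1} F_r + F_r^2 = 1. *)

Section GenFib.
Variable k : fieldType.
Implicit Types x y t : k.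

Lemma genfib_at0 x y : genfib_at 0 x y = 1.
Proof. by rewrite /genfib_at rmorph1. Qed.

Lemma genfib_at1 x y : genfib_at 1 x y = x.
Proof.
rewrite /genfib_at /genfib /= mulr1 mulr0 subr0.
by rewrite mmapX mmap1U.
Qed.

Lemma genfib_atSS r x y :
  genfib_at r.+2 x y = x * genfib_at r.+1 x y - y ^+ 2 * genfib_at r x y.
Proof.
rewrite /genfib_at /genfib -[genfib_shift r.+3]/
  ('X_0 * genfib_shift r.+2 - 'X_1 ^+ 2 * genfib_shift r.+1).
by rewrite rmorphB !rmorphM /= !mmapX !mmap1U expr2.
Qed.

(** [genfib r] is homogeneous of degree [r] and has the parity of [r] in its first variable. The
    recurrence has depth two, so two consecutive indices are carried through the induction. *)
Lemma genfib_at_scale r t y :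
  genfib_at r (- t * y) y = (- y) ^+ r * genfib_at r t 1.
Proof.
suff: genfib_at r (- t * y) y = (- y) ^+ r * genfib_at r t 1 /\
      genfib_at r.+1 (- t * y) y = (- y) ^+ r.+1 * genfib_at r.+1 t 1 by case.
elim: r => [|r [IH IH1]].
  by rewrite !genfib_at0 !genfib_at1; split; ring.
by split=> //; rewrite !genfib_atSS IH IH1 !exprS; ring.
Qed.

(** The form u^2 - t u v + v^2 is invariant under (u, v) -> (t u - v, u), which is one step of the
    recurrence at y = 1. It is det(u x - v) for x of trace t and determinant 1. *)
Lemma genfib_at_norm r t :
  genfib_at r.+1 t 1 ^+ 2 - t * genfib_at r.+1 t 1 * genfib_at r t 1
    + genfib_at r t 1 ^+ 2 = 1.
Proof.
elim: r => [|r IH]; first by rewrite genfib_at0 genfib_at1; ring.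
by rewrite genfib_atSS -[RHS]IH; ring.
Qed.

End GenFib.

Section Matrices2.
Variable k : fieldType.
Implicit Types a b c d : k.

Lemma ord2_cases (i : 'I_2) : i = 0 \/ i = 1.
Proof. by case: i => [[|[|//]] p]; [left|right]; exact: val_inj. Qed.

Lemma mx2_eta (x : 'M[k]_2) : x = mx2 (x 0 0) (x 0 1) (x 1 0) (x 1 1).
Proof.
apply/matrixP=> i j; rewrite mxE.
by case: (ord2_cases i) => ->; case: (ord2_cases j) => ->.
Qed.

Lemma mx2_inj a b c d a' b' c' d' :
  mx2 a b c d = mx2 a' b' c' d' -> [/\ a = a', b = b', c = c' & d = d'].
Proof.
move=> /matrixP e.
by split; [move: (e 0 0)|move: (e 0 1)|move: (e 1 0)|move: (e 1 1)]; rewrite !mxE.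
Qed.

Lemma mul_mx2 a b c d a' b' c' d' :
  mx2 a b c d *m mx2 a' b' c' d' =
  mx2 (a * a' + b * c') (a * b' + b * d') (c * a' + d * c') (c * b' + d * d').
Proof.
by apply/matrixP=> i j; rewrite !mxE !big_ord_recl big_ord0 !mxE /= addr0;
  case: (i == 0); case: (j == 0).
Qed.

Lemma det_mx2E a b c d : \det (mx2 a b c d) = a * d - b * c.
Proof.
rewrite (expand_det_row _ 0) !big_ord_recl big_ord0 /cofactor !det_mx11 !mxE /=.
by rewrite expr0 expr1; ring.
Qed.

Lemma scale_mx2_sub (u v : k) a b c d :
  u *: mx2 a b c d - v%:M = mx2 (u * a - v) (u * b) (u * c) (u * d - v).
Proof.
apply/matrixP=> i j; rewrite !mxE.
by case: (ord2_cases i) => ->; case: (ord2_cases j) => ->; rewrite /= ?subr0.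
Qed.

(** Iterated Cayley-Hamilton: x^2 = (a + d) x - 1. Starting at exponent 2 keeps the index -1
    away. *)
Lemma exp_mx2 a b c d r : a * d - b * c = 1 ->
  mx2 a b c d ^+ r.+2 =
  genfib_at r.+1 (a + d) 1 *: mx2 a b c d - (genfib_at r (a + d) 1)%:M.
Proof.
move=> det1; have adE : a * d = 1 + b * c by rewrite -det1 subrK.
elim: r => [|r IH].
  rewrite genfib_at0 genfib_at1 scale_mx2_sub expr2 [LHS]mul_mx2.
  by congr mx2; ring: adE.
rewrite exprS IH !scale_mx2_sub [LHS]mul_mx2 genfib_atSS.
set u := genfib_at r.+1 _ _; set v := genfib_at r _ _.
by congr mx2; ring: adE.
Qed.

Lemma bruhat_mx2 (tau psi alpha : k) :
  X12 tau *m nmx alpha *m X12 psi =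
  mx2 (- tau / alpha) (alpha - tau * psi / alpha) (- alpha^-1) (- psi / alpha).
Proof. by rewrite !mul_mx2; congr mx2; ring. Qed.

End Matrices2.

(** The condition [Y != 0] excludes X = Y = 0, which solves both equations whenever n >= 3. *)
Theorem proposition4p4 (k : fieldType) (n : nat) (tau psi alpha : k)
    (hchar : 2%N \notin [pchar k]) (hn : (2 <= n)%N) (halpha : alpha != 0) :
  (exists2 x : 'M[k]_2, x \in SL2 k & x ^+ n = X12 tau *m nmx alpha *m X12 psi)
  <->
  (exists X Y : k,
    [/\ Y != 0,
        2 * alpha * genfib_at (n - 2) X Y + (-1) ^+ (n - 2) * X * Y ^+ (n - 2)
          + (-1) ^+ (n - 1) * (tau + psi) * Y ^+ (n - 2) = 0
      & alpha * genfib_at (n - 1) X Y + (-1) ^+ n * Y ^+ n = 0]).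
Proof.
case: n hn => [|[|m]] // _.
rewrite -[(m.+2 - 1)%N]/m.+1 (_ : (m.+2 - 2)%N = m); last by rewrite !subSS subn0.
rewrite bruhat_mx2.
(* After the substitution X = -tY a power of -Y splits off each equation; for nonzero Y only the
   second factors matter. *)
have eq1E t Y : 2 * alpha * genfib_at m (- t * Y) Y
    + (-1) ^+ m * (- t * Y) * Y ^+ m + (-1) ^+ m.+1 * (tau + psi) * Y ^+ m
    = (- Y) ^+ m * (2 * alpha * genfib_at m t 1 - t * Y - (tau + psi)).
  by rewrite genfib_at_scale exprS (exprNn Y); ring.
have eq2E t Y : alpha * genfib_at m.+1 (- t * Y) Y + (-1) ^+ m.+2 * Y ^+ m.+2
    = (- Y) ^+ m.+1 * (alpha * genfib_at m.+1 t 1 - Y).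
  by rewrite genfib_at_scale (exprNn Y) !exprS; ring.
split.
  case=> x; rewrite inE (mx2_eta _ x).
  move: (x 0 0) (x 0 1) (x 1 0) (x 1 1) => a b c d; rewrite det_mx2E => /eqP det1.
  rewrite exp_mx2 // scale_mx2_sub => /mx2_inj.
  set u := genfib_at m.+1 _ _; set v := genfib_at m _ _ => -[ea _ ec ed].
  have u0 : u != 0.
    apply: contraNneq halpha => u0.
    by move/eqP: ec; rewrite u0 mul0r eq_sym oppr_eq0 invr_eq0.
  exists (- (a + d) * (alpha * u)), (alpha * u); split.
  - by rewrite mulf_neq0.
  - rewrite eq1E -/v.
    have -> : tau = - alpha * (u * a - v) by rewrite ea; field.
    have -> : psi = - alpha * (u * d - v) by rewrite ed; field.
    ring.
  - by rewrite eq2E -/u; ring.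
case=> X [Y [Y0]]; pose t := - X / Y.
have -> : X = - t * Y by rewrite /t; field.
rewrite eq1E eq2E => /eqP; rewrite mulf_eq0 expf_eq0 oppr_eq0 (negPf Y0) andbF /=.
move=> /eqP e1 /eqP; rewrite mulf_eq0 expf_eq0 oppr_eq0 (negPf Y0) /=.
rewrite subr_eq0 => /eqP e2.
have := genfib_at_norm k m t.
move: e1 e2; set u := genfib_at m.+1 _ _; set v := genfib_at m _ _ => e1 e2 e3.
(* Forced by the diagonal of u x - v = g with u = Y / alpha; the off-diagonal entries of the witness
   below arise the same way. *)
pose a := (alpha * v - tau) / Y; pose d := (alpha * v - psi) / Y.
have tr : a + d = t.
  by apply: (mulIf Y0); rewrite /a /d -[RHS]addr0 -e1; field.
have uE : u = Y / alpha by rewrite -e2; field.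
have det1 : a * d - (alpha ^+ 2 - tau * psi) / Y * (- Y^-1) = 1.
  have psiE : psi = 2 * alpha * v - t * Y - tau.
    by apply/eqP; rewrite eq_sym -subr_eq0 -e1; apply/eqP; ring.
  (* The norm identity [e3] multiplied by alpha^2, with alpha u = Y. *)
  have e4 : Y ^+ 2 - t * Y * (alpha * v) + (alpha * v) ^+ 2 = alpha ^+ 2.
    by rewrite -[RHS]mulr1 -e3 -e2; ring.
  by rewrite /a /d -e4 psiE; field.
exists (mx2 a ((alpha ^+ 2 - tau * psi) / Y) (- Y^-1) d).
  by rewrite inE det_mx2E det1.
rewrite exp_mx2 // scale_mx2_sub tr -/u -/v uE.
by congr mx2; rewrite /a /d; field; rewrite ?halpha ?Y0.
Qed.
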